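(* There are $1, 15, 50, 60, 120$ diagonal polynomials induced by the reliability polynomial $$R_{Mc}=R_1R_4+R_2R_5+R_2R_3R_4-R_1R_2R_3R_4-R_1R_2R_4R_5-R_2R_3R_4R_5+R_1R_2R_3R_4R_5,$$ corresponding to $1,2,3,4,5$ variables, respectively.
   Context: $R_{Mc}$ is the multivariate reliability polynomial of a bridge network with five components, in the variables $R_1,\dots,R_5$ (the reliabilities of the components). The diagonal polynomials induced by $R_{Mc}$ are its restrictions via equi-reliable components, that is, the polynomials obtained from $R_{Mc}$ by replacing $R_1,\dots,R_5$ by $k$ variables ($1\le k\le 5$), with components taken to be equally reliable receiving the same variable. The restrictions considered are: for one variable, all $R_i$ equal $x$; for two variables, one $R_i$ equals $x$ and the other four equal $y$, or two equal $x$ and the other three equal $y$; for three variables, one equals $x$, another equals $y$ and the other three equal $z$, or one equals $x$, two equal $y$ and two equal $z$; for four variables, one equals $x$, another $y$, another $z$ and the other two equal $w$; for five variables, the $R_i$ are a permutation of the five variables. For example, $R_1=\dots=R_5=x$ gives the diagonal polynomial $2x^2+x^3-3x^4+x^5$, and $R_1=x$, $R_2=R_3=R_4=R_5=y$ gives the diagonal polynomial $xy-2xy^3+xy^4+y^2+y^3-y^4$.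
   Formalization: The diagonal polynomials are counted once per restriction, with repetitions: different restrictions can give equal polynomials (R_1=x, others y, and R_5=x, others y), so the numbers of distinct polynomials are smaller than those stated. *)

(* Defs.v *)
From HB Require Import structures.
From mathcomp Require Import all_boot all_order all_algebra.
From mathcomp Require Import mpoly.

Set Implicit Arguments.
Unset Strict Implicit.
Unset Printing Implicit Defensive.

Import GRing.Theory.
Local Open Scope ring_scope.

(* The components are numbered 1 to 5: the variable R_i is 'X_(i - 1). *)
Definition rel_var (i : nat) : {mpoly int[5]} := 'X_(inord i.-1).

Definition R_Mc : {mpoly int[5]} :=
  let R := rel_var in
  R 1%N * R 4%N + R 2%N * R 5%N + R 2%N * R 3%N * R 4%N
  - R 1%N * R 2%N * R 3%N * R 4%N - R 1%N * R 2%N * R 4%N * R 5%N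
  - R 2%N * R 3%N * R 4%N * R 5%N
  + R 1%N * R 2%N * R 3%N * R 4%N * R 5%N.

(* For each kind of restriction, the number of components which receive the
   first variable x, the second variable y, and so on. *)
Definition restriction_patterns : seq (seq nat) :=
  [:: [:: 5];
      [:: 1; 4]; [:: 2; 3];
      [:: 1; 1; 3]; [:: 1; 2; 2];
      [:: 1; 1; 1; 2];
      [:: 1; 1; 1; 1; 1]]%N.

(* f assigns to each of the five components one of the k variables. *)
Definition multiplicities (k : nat) (f : {ffun 'I_5 -> 'I_k}) : seq nat :=
  [seq #|[set i | f i == j]| | j <- enum 'I_k].

Definition restrictions (k : nat) : {set {ffun 'I_5 -> 'I_k}} :=
  [set f | multiplicities f \in restriction_patterns].

Definition diagonal_polynomial (k : nat) (f : {ffun 'I_5 -> 'I_k}) :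
    {mpoly int[k]} :=
  R_Mc \mPo [tuple 'X_(f i) | i < 5].

(* One entry per restriction.  Repetitions are kept: R_Mc is invariant under
   exchanging R_1 with R_5 and R_2 with R_4 simultaneously, so that distinct
   restrictions may induce equal polynomials (e.g. R_1 = x and R_5 = x, all
   other reliabilities being y), and these are counted separately. *)
Definition diagonal_polynomials (k : nat) : seq {mpoly int[k]} :=
  [seq diagonal_polynomial f | f in restrictions k].

(* Main.v *)
Require Import Defs.
From mathcomp Require Import all_boot all_order all_algebra.
From mathcomp Require Import mpoly.

(** A restriction is a word of length 5 over the alphabet of the k variables,
    and its multiplicities are the letter counts of that word; there are at
    most 5^5 words, so the restrictions are counted by enumeration. *)

Fixpoint words (n k : nat) : seq (seq nat) :=
  if n is m.+1 then [seq i :: w | i <- iota 0 k, w <- words m k] else [:: [::]].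

Definition word_of {n k} (f : {ffun 'I_n -> 'I_k}) : seq nat :=
  [seq val j | j <- codom f].

Lemma mem_words n k w :
  (w \in words n k) = (size w == n) && all (fun i => i < k) w.
Proof.
elim: n w => [|n IHn] [|i w] //=.
  by apply/negbTE/negP => /allpairsP[p []].
rewrite eqSS andbCA -IHn; apply/allpairsP/andP.
  by move=> [[j v] [/= + v_w [-> ->]]]; rewrite mem_iota.
by case=> ik w_w; exists (i, w); rewrite mem_iota.
Qed.

Lemma uniq_words n k : uniq (words n k).
Proof.
elim: n => //= n IHn; apply: allpairs_uniq => //; first exact: iota_uniq.
by move=> [i v] [j w] _ _ [-> ->].
Qed.

Lemma word_of_inj n k : injective (@word_of n k).
Proof.
move=> f g /(inj_map val_inj) /eq_in_map eq_fg.
by apply/ffunP => i; apply: eq_fg; rewrite mem_enum.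
Qed.

(** Both lists are duplicate-free, so comparing their members is enough. This carries counts over
    finite functions to lists of naturals, which can be evaluated directly. *)
Lemma perm_word_of n k :
  perm_eq [seq word_of f | f : {ffun 'I_n -> 'I_k}] (words n k).
Proof.
apply: uniq_perm; first by rewrite map_inj_uniq ?enum_uniq //; apply: word_of_inj.
  exact: uniq_words.
move=> w; rewrite mem_words; apply/mapP/andP.
  case=> f _ ->; rewrite size_map size_codom card_ord eqxx; split=> //.
  by apply/allP => _ /mapP[j _ ->]; apply: ltn_ord.
case=> /eqP size_w /allP w_k.
(* The preimage of [w] sends [i] to the [i]-th letter. The default 0 is never reached, since [w] has
   length [n]. *)
have wP (i : 'I_n) : nth 0 w i < k by rewrite w_k ?mem_nth ?size_w.
exists [ffun i => Ordinal (wP i)]; first exact: mem_enum.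
rewrite /word_of codomE -map_comp.
apply: (@eq_from_nth _ 0) => [|i]; rewrite size_w.
  by rewrite size_map size_enum_ord.
move=> lt_in.
by rewrite (nth_map (Ordinal lt_in)) ?size_enum_ord //= ffunE /= nth_enum_ord.
Qed.

(** The word lists the values of [f] over the five components, so the letter [j] occurs once for
    each element of the fibre of [f] over [j]. *)
Lemma multiplicities_word_of k (f : {ffun 'I_5 -> 'I_k}) :
  multiplicities f = [seq count_mem j (word_of f) | j <- iota 0 k].
Proof.
rewrite -val_enum_ord -map_comp; apply: eq_map => j /=.
rewrite /word_of codomE !count_map cardE size_filter -enumT.
by apply: eq_count => i; rewrite !inE.
Qed.

(** Repetitions are kept in [diagonal_polynomials], so its size is the number of restrictions. *)
Lemma size_diagonal_polynomials k :
  size (diagonal_polynomials k) =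
  count (fun w => [seq count_mem j w | j <- iota 0 k] \in restriction_patterns)
        (words 5 k).
Proof.
rewrite size_image cardE size_filter -(permP (perm_word_of 5 k)) count_map -enumT.
by apply: eq_count => f; rewrite !inE /= multiplicities_word_of.
Qed.

Theorem theorem4p3 :
  [/\ size (diagonal_polynomials 1) = 1,
      size (diagonal_polynomials 2) = 15,
      size (diagonal_polynomials 3) = 50,
      size (diagonal_polynomials 4) = 60
    & size (diagonal_polynomials 5) = 120].
(* Pattern by pattern, the multinomial coefficients give 1, 5 + 10, 20 + 30, 60 and 120. *)
Proof. by rewrite !size_diagonal_polynomials; split; vm_compute. Qed.
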